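(* If $G$ is a group generated by an invertible and reversible Mealy automaton, then $G$ is of exponential growth as soon as it contains an element of infinite order. In particular, no infinite virtually nilpotent group can be generated by an invertible and reversible Mealy automaton.
   Context: A Mealy automaton is a tuple $\mathcal{M}=(Q,A,\tau)$ where $Q$ (states) and $A$ (alphabet) are finite sets and $\tau\colon Q\times A\to A\times Q$ is a map; write $\tau(q,a)=(q\cdot a,\,q@a)$. It is invertible if for every $q\in Q$ the map $A\to A$, $a\mapsto q\cdot a$, is a bijection, and reversible if for every $a\in A$ the map $Q\to Q$, $q\mapsto q@a$, is a bijection. $Q^*$ and $A^*$ denote the free monoids (finite words, with empty word $\epsilon$). The operations extend uniquely to a left action $\cdot$ of $Q^*$ on the set $A^*$ and a right action $@$ of $A^*$ on the set $Q^*$ by: $s\cdot\epsilon=\epsilon$, $s@\epsilon=s$, $\epsilon\cdot u=u$, $\epsilon@u=\epsilon$, $s\cdot(uv)=(s\cdot u)\,((s@u)\cdot v)$, $s@(uv)=(s@u)@v$, $(st)\cdot u=s\cdot(t\cdot u)$, $(st)@u=(s@(t\cdot u))\,(t@u)$. Put $P_{\mathcal{M}}=Q^*/{\stackrel{Q}{\sim}}$, where $s\stackrel{Q}{\sim}t$ iff $s\cdot u=t\cdot u$ for all $u\in A^*$. For $\mathcal{M}$ invertible, the enriched automaton is $\widetilde{\mathcal{M}}=(Q\sqcup Q^{-1},A,\widetilde{\tau})$, where $Q^{-1}=\{q^{-1}\mid q\in Q\}$ is a set of formal inverses, $\widetilde\tau(q,a)=\tau(q,a)$ and $\widetilde\tau(q^{-1},q\cdot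 a)=(a,(q@a)^{-1})$ for all $q\in Q$, $a\in A$. Then $P_{\widetilde{\mathcal{M}}}$ is a group in which (the classes of) $q$ and $q^{-1}$ are inverse; the group generated by $\mathcal{M}$ (the automaton group) is $P_{\widetilde{\mathcal{M}}}$. *)

(* Defs.v *)
From HB Require Import structures.
From mathcomp Require Import all_boot all_order all_algebra.
From mathcomp Require Import finmap generic_quotient.
From mathcomp Require Import boolp classical_sets functions cardinality reals.

Set Implicit Arguments.
Unset Strict Implicit.
Unset Printing Implicit Defensive.

Import Algebra.

Local Open Scope classical_set_scope.
Local Open Scope group_scope.
Local Open Scope quotient_scope.

Record mealy := Mealy {
  state : finType;
  letter : finType;
  tau : state * letter -> letter * state
}.

Definition out (M : mealy) (q : state M) (a : letter M) : letter M :=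
  (tau (q, a)).1.

Definition next (M : mealy) (q : state M) (a : letter M) : state M :=
  (tau (q, a)).2.

Definition invertible (M : mealy) : Prop :=
  forall q : state M, bijective (fun a : letter M => out q a).

Definition reversible (M : mealy) : Prop :=
  forall a : letter M, bijective (fun q : state M => next q a).

(* The unique extensions to words of  q . a  and  q @ a :  [act s u] is s . u
   and [sect s u] is s @ u.  Words of states act on the left, so the last
   letter of [s] acts first; [act1]/[sect1] treat a single state.  The lemmas
   [act_nil_r] to [sect_letter] are the identities characterizing them. *)
Section WordActions.
Variable M : mealy.
Implicit Types (q : state M) (s t : seq (state M)) (u v : seq (letter M)).

Fixpoint act1 q u : seq (letter M) :=
  if u is a :: u' then out q a :: act1 (next q a) u' else [::].

Definition sect1 q u : state M := foldl (@next M) q u.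

Definition act s u : seq (letter M) := foldr act1 u s.

Fixpoint sect s u : seq (state M) :=
  if s is q :: t then sect1 q (act t u) :: sect t u else [::].

Lemma act1_cat q u v : act1 q (u ++ v) = act1 q u ++ act1 (sect1 q u) v.
Proof. by elim: u q => //= a u IHu q; rewrite IHu. Qed.

Lemma act_nil_r s : act s [::] = [::].
Proof. by elim: s => //= q s ->. Qed.

Lemma sect_nil_r s : sect s [::] = s.
Proof. by elim: s => //= q s ->; rewrite act_nil_r. Qed.

Lemma act_cat_r s u v : act s (u ++ v) = act s u ++ act (sect s u) v.
Proof. by elim: s => //= q s ->; rewrite act1_cat. Qed.

Lemma sect_cat_r s u v : sect s (u ++ v) = sect (sect s u) v.
Proof.
by elim: s => //= q s ->; rewrite act_cat_r /sect1 foldl_cat.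
Qed.

Lemma act_cat_l s t u : act (s ++ t) u = act s (act t u).
Proof. exact: foldr_cat. Qed.

Lemma sect_cat_l s t u : sect (s ++ t) u = sect s (act t u) ++ sect t u.
Proof. by elim: s => //= q s ->; rewrite act_cat_l. Qed.

Lemma act_letter q (a : letter M) : act [:: q] [:: a] = [:: out q a].
Proof. by []. Qed.

Lemma sect_letter q (a : letter M) : sect [:: q] [:: a] = [:: next q a].
Proof. by []. Qed.

Definition act_eq s t : bool := `[< forall u, act s u = act t u >].

Lemma act_eqP s t : reflect (forall u, act s u = act t u) (act_eq s t).
Proof. exact: asboolP. Qed.

Lemma act_eq_refl : reflexive act_eq.
Proof. by move=> s; apply/act_eqP. Qed.

Lemma act_eq_sym : symmetric act_eq.
Proof. by move=> s t; apply/act_eqP/act_eqP => e u; rewrite e. Qed.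

Lemma act_eq_trans : transitive act_eq.
Proof.
by move=> t s r /act_eqP st /act_eqP tr; apply/act_eqP => u; rewrite st tr.
Qed.

Canonical act_equiv := EquivRel act_eq act_eq_refl act_eq_sym act_eq_trans.

Definition automaton_monoid := {eq_quot act_equiv}.

HB.instance Definition _ := Choice.on automaton_monoid.
HB.instance Definition _ : EqQuotient _ act_equiv automaton_monoid :=
  EqQuotient.on automaton_monoid.

Definition pi_word (s : seq (state M)) : automaton_monoid :=
  \pi_(automaton_monoid) s.

Lemma pi_wordP s t :
  reflect (forall u, act s u = act t u) (pi_word s == pi_word t).
Proof. by rewrite /pi_word piE; exact: act_eqP. Qed.

Lemma pi_word_repr (x : automaton_monoid) : pi_word (repr x) = x.
Proof. exact: reprK. Qed.

Lemma act_repr s u : act (repr (pi_word s)) u = act s u.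
Proof. by move: u; apply/pi_wordP; rewrite pi_word_repr. Qed.

Definition am_one : automaton_monoid := pi_word [::].

Definition am_mul (x y : automaton_monoid) : automaton_monoid :=
  pi_word (repr x ++ repr y).

Lemma am_mulE s t : am_mul (pi_word s) (pi_word t) = pi_word (s ++ t).
Proof. by apply/eqP/pi_wordP => u; rewrite !act_cat_l !act_repr. Qed.

Lemma am_mulA : associative am_mul.
Proof.
move=> x y z; rewrite -[x]pi_word_repr -[y]pi_word_repr -[z]pi_word_repr.
by rewrite !am_mulE catA.
Qed.

Lemma am_mul1 : left_id am_one am_mul.
Proof. by move=> x; rewrite -[x]pi_word_repr am_mulE. Qed.

Lemma am_1mul : right_id am_one am_mul.
Proof. by move=> x; rewrite -[x]pi_word_repr am_mulE cats0. Qed.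

HB.instance Definition _ :=
  isMonoid.Build automaton_monoid am_mulA am_mul1 am_1mul.

Lemma pi_word_nil : pi_word [::] = 1.
Proof. by []. Qed.

Lemma pi_word_cat s t : pi_word (s ++ t) = pi_word s * pi_word t.
Proof. by rewrite -am_mulE. Qed.

End WordActions.

(* [inl q] is the state q, and [inr q] its formal inverse. *)
Section Enriched.
Variables (M : mealy) (invM : invertible M).
Implicit Types (q : state M) (a : letter M).

Definition out_inv q : letter M -> letter M := invF (bij_inj (invM q)).

Definition enriched_tau (x : (state M + state M) * letter M) :
    letter M * (state M + state M) :=
  match x with
  | (inl q, a) => (out q a, inl (next q a))
  | (inr q, b) => let a := out_inv q b in (a, inr (next q a))
  end.

Definition enriched : mealy := Mealy enriched_tau.

Lemma enriched_tauV q a :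
  @tau enriched (inr q, out q a) = (a, inr (next q a)).
Proof. by rewrite /= /out_inv invF_f. Qed.

Definition flip (x : state enriched) : state enriched :=
  match x with inl q => inr q | inr q => inl q end.

Lemma flipK : involutive flip.
Proof. by case. Qed.

Lemma act1_flip (x : state enriched) u : act1 (flip x) (act1 x u) = u.
Proof.
elim: u x => //= a u IHu [q|q] /=.
  have e : out_inv q (out q a) = a by rewrite /out_inv invF_f.
  by rewrite {1}/out /= {1}/next /= {1 2}/out /= e (IHu (inl _)).
have e : out q (out_inv q a) = a by rewrite /out_inv f_invF.
by rewrite {1}/out /= {1}/next /= e (IHu (inr _)).
Qed.

Definition word_inv (s : seq (state enriched)) : seq (state enriched) :=
  rev (map flip s).

Lemma act_word_inv s u : act (word_inv s) (act s u) = u.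
Proof.
elim: s u => //= x s IHs u.
by rewrite /word_inv /= rev_cons -cats1 act_cat_l /= act1_flip IHs.
Qed.

Lemma word_invK : involutive word_inv.
Proof.
move=> s; rewrite /word_inv map_rev revK -map_comp -[RHS]map_id.
by apply: eq_map => x /=; rewrite flipK.
Qed.

Definition automaton_group := automaton_monoid enriched.

HB.instance Definition _ := Monoid.on automaton_group.

Definition ag_inv (x : automaton_group) : automaton_group :=
  pi_word (word_inv (repr x)).

HB.instance Definition _ := hasInv.Build automaton_group ag_inv.

Lemma ag_mulVg : left_inverse (1 : automaton_group) ag_inv *%g.
Proof.
move=> x; rewrite /ag_inv -{2}[x](@pi_word_repr enriched).
rewrite -[_ * _](@pi_word_cat enriched).
by apply/eqP/pi_wordP => u; rewrite act_cat_l act_word_inv.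
Qed.

Lemma ag_mulgV : right_inverse (1 : automaton_group) ag_inv *%g.
Proof.
move=> x; rewrite /ag_inv -{1}[x](@pi_word_repr enriched).
rewrite -[_ * _](@pi_word_cat enriched).
apply/eqP/pi_wordP => u.
by rewrite act_cat_l -{1}[repr x]word_invK act_word_inv.
Qed.

HB.instance Definition _ :=
  Monoid_isGroup.Build automaton_group ag_mulVg ag_mulgV.

(* Up to isomorphism. *)
Definition generates (G : groupType) : Prop :=
  exists f : {multiplicative automaton_group -> G}, bijective f.

End Enriched.

Section GroupProperties.
Variable G : groupType.
Implicit Types (g x y : G) (S H : set G) (n : nat).

Definition infinite_order g : Prop := forall n, (0 < n)%N -> g ^+ n <> 1.

Definition ball S n : set G :=
  [set g | exists w : seq G,
     [/\ (size w <= n)%N,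
         (forall x, x \in w -> S x \/ S x^-1)
       & g = \prod_(x <- w) x]].

Lemma finite_ball S n : finite_set S -> finite_set (ball S n).
Proof.
move=> finS.
have finT : finite_set (S `|` [set x^-1 | x in S]).
  by rewrite finite_setU; split => //; exact: finite_image.
elim: n => [|n IHn].
  apply: (@sub_finite_set _ _ [set 1]) => // g [w []].
  by rewrite leqn0 size_eq0 => /eqP -> _ ->; rewrite big_nil.
apply: (@sub_finite_set _ _ (ball S n `|`
  [set x * y | x in S `|` [set x^-1 | x in S] & y in ball S n])); last first.
  by rewrite finite_setU; split => //; exact: finite_image2.
move=> g [[|x w] [sw Sw ->]]; first by left; exists [::].
right; rewrite big_cons; exists x.
  have [?|Sx] := Sw x (mem_head _ _); [by left | right].
  by exists x^-1 => //; rewrite invgK.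
exists (\prod_(z <- w) z) => //; exists w; split => // z zw.
by apply: Sw; rewrite inE zw orbT.
Qed.

Definition growth S n : nat := #|` fset_set (ball S n) |%fset.

Definition generating S : Prop := forall g, exists n, ball S n g.

(* The rate of growth does not depend on the finite generating set, so
   quantifying over all of them loses nothing; the first conjunct excludes
   groups that are not finitely generated. *)
Definition exponential_growth (R : realType) : Prop :=
  (exists S, finite_set S /\ generating S) /\
  (forall S, finite_set S -> generating S ->
     exists c : R, (1 < c)%R /\ forall n, (c ^+ n <= (growth S n)%:R)%R).

Definition is_subgroup H : Prop := group_closed (mem H).

Definition finite_index H : Prop :=
  finite_set (range (fun g => [set g * h | h in H])).

Fixpoint upper_central H n : set G :=
  if n is m.+1
  then [set x | H x /\ forall y, H y -> upper_central H m [~ x, y]]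
  else [set 1].

Definition nilpotent H : Prop := exists n, upper_central H n = H.

Definition virtually_nilpotent : Prop :=
  exists H, [/\ is_subgroup H, finite_index H & nilpotent H].

End GroupProperties.

(* Main.v *)
Require Import Defs.
From mathcomp Require Import all_boot all_order all_algebra ring.
From mathcomp Require Import finmap boolp classical_sets cardinality reals.

(** The core is that an element of infinite order forces a free monoid of rank two;
    both claims follow from this.

    Let [q] be a state of infinite order; call a word of states an element when only
    its action matters. Reading letters permutes the words of states of each length
    (reversibility), and reading [s ++ t] reads [t] first and then [s] along the image
    under [t]. Consider the language of all words in the orbits of the powers
    [q ^ n]. The number of letters that can be put on the left of such a word depends
    only on its length and does not increase with it. Once it is constant, from length
    [k] on, the possible left extensions of a word depend on its first [k] letters
    only ([left_ext_prefix]), so words that overlap in [k] letters can be glued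
    ([power_orbit_glue]). Write [K] for [q ^ k] and call [x] a loop if [K ++ x ++ K]
    is in the language.

    For a loop [x] let [last_letters x] be the set of last letters of the loops of the
    same length that are equal to [x] as elements. Its cardinality depends on the
    length only ([card_last_letters]), and it can only grow when a loop is put on the
    left of [x] ([last_letters_glue]). This is a combinatorial form of the fact that
    for a random walk the entropy of the first step given the position at time [n]
    does not decrease with [n]. There are two cases.
    - If for large [n] every left extension of [K] is in [last_letters (q ^ n)], then
      in long loops the last letter can be replaced by [q] without changing the element
      ([loop_peel]). Repeating this, the elements in the orbit of [q ^ n] are described
      by a bounded amount of data, so two powers of [q] are equal
      ([covered_orbit_repeat]), against infinite order.
    - Otherwise some left extension [p] of [K] is never in [last_letters (q ^ n)]. Words
      of the language recur ([power_orbit_recurrent]), so [p] is the last letter of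
      some loop [y]. For long [y], [last_letters] is not changed by loops put on the
      left, so it distinguishes the elements given by words ending in [K ++ y] from
      those given by words of the same length ending in [K ++ q ^ (size y)]. These two
      blocks therefore generate a free monoid ([block_word_inj]).

    If the group has an element of infinite order, so does the semigroup of positive
    words, since otherwise inverses would be positive powers. A positive word is a state
    of a power of the automaton, so the group contains a free monoid of rank two
    ([automaton_free_pair]) and has exponential growth.

    A virtually nilpotent group contains no such monoid, because nilpotent groups
    satisfy a semigroup law ([virtually_nilpotent_not_free]). Hence a virtually
    nilpotent group generated by such an automaton is a torsion group; being finitely
    generated it is finite ([torsion_nilpotent_finite]). *)

Set Implicit Arguments.
Unset Strict Implicit.
Unset Printing Implicit Defensive.

(** * Actions of words *)

Section WordActionTheory.
Variable M : mealy.
Implicit Types (q : state M) (s t : seq (state M)) (u v : seq (letter M)).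

Lemma size_act s u : size (act s u) = size u.
Proof.
elim: s => //= q s <-; move: (act s u) => v.
by elim: v q => //= a v IHv q; rewrite IHv.
Qed.

Lemma size_sect s u : size (sect s u) = size s.
Proof. by elim: s => //= q s ->. Qed.

Lemma eq_act_sect s t u : act s =1 act t -> act (sect s u) =1 act (sect t u).
Proof.
move=> st v; have := st (u ++ v); rewrite !act_cat_r st.
by move/(congr1 (drop (size (act t u)))); rewrite !drop_size_cat.
Qed.

Lemma eq_act_cat s s' t t' :
  act s =1 act s' -> act t =1 act t' -> act (s ++ t) =1 act (s' ++ t').
Proof. by move=> ss tt u; rewrite !act_cat_l ss tt. Qed.

Hypothesis invM : invertible M.

Lemma act1_surj q u : exists v, act1 q v = u.
Proof.
elim: u q => [|a u IHu] q; first by exists [::].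
have [g _ gK] := invM q; have [v e] := IHu (Defs.next q (g a)).
by exists (g a :: v); rewrite /= gK e.
Qed.

Lemma act_surj s u : exists v, act s v = u.
Proof.
elim: s u => [|q s IHs] u; first by exists u.
by have [v <-] := act1_surj q u; have [w <-] := IHs v; exists w.
Qed.

Lemma act_inj s : injective (act s).
Proof.
elim: s => [|q s IHs] // u v /= e; apply: IHs; move: (act s u) (act s v) e.
move=> {}u {v}; elim: u q => [|a u IHu] q [|b v] //= [ab].
by rewrite (bij_inj (invM q) ab) => /IHu ->.
Qed.

(** The word acting first can be cancelled, since it acts surjectively. *)
Lemma eq_act_cat2r s t r : act (s ++ r) =1 act (t ++ r) -> act s =1 act t.
Proof.
by move=> e u; have [v <-] := act_surj r u; rewrite -!act_cat_l e.
Qed.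

Hypothesis revM : reversible M.

Lemma sect1_bij u : bijective (fun q => sect1 q u).
Proof.
elim: u => [|a u IHu]; first by exists id.
exact: (bij_comp IHu (revM a)).
Qed.

Lemma sect_inj s t u : size s = size t -> sect s u = sect t u -> s = t.
Proof.
elim: s t => [|q s IHs] [|r t] //= [st] [+ /IHs e]; rewrite e // => qr.
by rewrite (bij_inj (sect1_bij (act t u)) qr).
Qed.

Lemma sect_surj t u : exists s, sect s u = t.
Proof.
elim: t => [|q t [s <-]]; first by exists [::].
by have [g _ gK] := sect1_bij (act s u); exists (g q :: s); rewrite /= gK.
Qed.

(** Words of a fixed length form a finite set, on which reading [u] is a
    permutation; so some power of [u] undoes it. *)
Lemma sect_return s u : exists v, sect (sect s u) v = s.
Proof.
have szP (x : (size s).-tuple (state M)) : size (sect x u) == size s.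
  by rewrite size_sect size_tuple.
pose f x := Tuple (szP x).
have fI : injective f.
  move=> x y /(congr1 val) /= /sect_inj e; apply: val_inj.
  by apply: e; rewrite !size_tuple.
have itf n x : val (iter n f x) = sect x (flatten (nseq n u)).
  elim: n x => [|n IHn] x; first by rewrite /= sect_nil_r.
  by rewrite iterSr IHn /= sect_cat_r.
pose x0 := in_tuple s; exists (flatten (nseq (order f x0).-1 u)).
rewrite -sect_cat_r -[LHS]/(sect x0 (flatten (nseq (order f x0).-1.+1 u))).
by rewrite -itf prednK ?order_gt0 // iter_order.
Qed.

End WordActionTheory.

(** * The orbits of the powers of a state *)

Section OrbitLanguage.
Variables (M : mealy) (invM : invertible M) (revM : reversible M).
Variable q : state M.
Local Notation Q := (state M).
Implicit Types (p : Q) (x y z w : seq Q) (u v : seq (letter M)).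

(** The orbits of the powers of [q] under reading, taken together, are handled as
    one language, stable under prefixes and suffixes. *)
Definition power_orbit w : Prop := exists u, sect (nseq (size w) q) u = w.
Local Notation L := power_orbit.

Lemma power_orbit_nseq n : L (nseq n q).
Proof. by exists [::]; rewrite sect_nil_r size_nseq. Qed.

Lemma power_orbit_sect w u : L w -> L (sect w u).
Proof.
by case=> v e; exists (v ++ u); rewrite size_sect sect_cat_r e.
Qed.

Lemma power_orbit_sect_inv w u : L (sect w u) -> L w.
Proof.
by have [v e] := sect_return revM w u => /(@power_orbit_sect _ v); rewrite e.
Qed.

Lemma power_orbit_trans x y :
  size x = size y -> L x -> L y -> exists u, sect x u = y.
Proof.
move=> sxy [u eu] [v ev]; have [w ew] := sect_return revM (nseq (size x) q) u.
by exists (w ++ v); rewrite sect_cat_r -eu ew sxy ev.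
Qed.

Lemma power_orbit_cat x y : L (x ++ y) -> L x /\ L y.
Proof.
case=> u; rewrite size_cat nseqD sect_cat_l => /eqP.
rewrite eqseq_cat ?size_sect ?size_nseq // => /andP[/eqP ex /eqP ey].
by split; [exists (act (nseq (size y) q) u) | exists u].
Qed.

Definition left_ext w : {set Q} := [set p | `[< L (p :: w) >]].

Lemma left_extP w p : reflect (L (p :: w)) (p \in left_ext w).
Proof. by rewrite inE; exact: asboolP. Qed.

(** A word of letters carrying [x] to [y] carries the left extensions of [x]
    injectively into those of [y]. *)
Lemma card_left_ext_le x y :
  size x = size y -> L x -> L y -> #|left_ext x| <= #|left_ext y|.
Proof.
move=> sxy Lx Ly; have [v ev] := power_orbit_trans sxy Lx Ly.
rewrite -(card_imset _ (bij_inj (sect1_bij revM (act x v)))).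
apply/subset_leq_card/fintype.subsetP => _ /imsetP[p /left_extP Lp ->].
by apply/left_extP; have := power_orbit_sect v Lp; rewrite /= ev.
Qed.

Lemma card_left_ext x y :
  size x = size y -> L x -> L y -> #|left_ext x| = #|left_ext y|.
Proof. by move=> s Lx Ly; apply/eqP; rewrite eqn_leq !card_left_ext_le. Qed.

Lemma left_ext_cat y z : left_ext (y ++ z) \subset left_ext y.
Proof.
apply/fintype.subsetP => p /left_extP.
by rewrite -cat_cons => /power_orbit_cat[Lpy _]; apply/left_extP.
Qed.

(** An extension of [q ^ n.+1] is one of [q ^ n], so the number of left extensions
    can only decrease. *)
Lemma left_ext_stable : exists k, forall n, k <= n ->
  #|left_ext (nseq n q)| = #|left_ext (nseq k q)|.
Proof.
pose P d := `[< exists k, #|left_ext (nseq k q)| = d >].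
have exP : exists d, P d.
  by exists #|left_ext (nseq 0 q)|; apply/asboolP; exists 0.
have [_ /asboolP[k <-] mind] := ex_minnP exP.
exists k => n kn; apply/eqP; rewrite eqn_leq mind ?andbT; last first.
  by apply/asboolP; exists n.
rewrite -{1}(subnKC kn) nseqD.
exact/subset_leq_card/left_ext_cat.
Qed.

Section Markov.
Variable k : nat.
Hypothesis kstable : forall n, k <= n ->
  #|left_ext (nseq n q)| = #|left_ext (nseq k q)|.
Local Notation K := (nseq k q).

(** The language is a topological Markov chain of order [k]: all words of length at
    least [k] have equally many left extensions, so the inclusion [left_ext_cat] is
    an equality. *)
Lemma left_ext_prefix y z :
  k <= size y -> L (y ++ z) -> left_ext (y ++ z) = left_ext y.
Proof.
move=> ky Lyz; apply/eqP; rewrite eqEcard left_ext_cat /=.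
have [Ly _] := power_orbit_cat Lyz.
rewrite (card_left_ext _ Ly (power_orbit_nseq (size y))) ?size_nseq //.
rewrite (card_left_ext _ Lyz (power_orbit_nseq (size (y ++ z)))) ?size_nseq //.
by rewrite !kstable // size_cat (leq_trans ky) ?leq_addr.
Qed.

Lemma power_orbit_glue x y z :
  k <= size y -> L (x ++ y) -> L (y ++ z) -> L (x ++ y ++ z).
Proof.
move=> ky; elim: x => [|p x IHx] //= Lpxy Lyz.
have Lxyz : L (x ++ y ++ z).
  by apply: IHx => //; have [] := @power_orbit_cat [:: p] _ Lpxy.
rewrite catA; apply/left_extP; rewrite left_ext_prefix -?catA //.
  exact/left_extP.
by rewrite size_cat (leq_trans ky) ?leq_addl.
Qed.

Lemma power_orbit_glueK x z : L (x ++ K) -> L (K ++ z) -> L (x ++ K ++ z).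
Proof. by apply: power_orbit_glue; rewrite size_nseq. Qed.

Lemma rcons_nseq n : rcons (nseq n q) q = q :: nseq n q.
Proof. by elim: n => //= n ->. Qed.

Lemma power_orbit_consK x : L (K ++ x) -> L (K ++ q :: x).
Proof.
move=> Lx; rewrite -cat_rcons rcons_nseq.
exact: (@power_orbit_glueK [:: q]) (power_orbit_nseq k.+1) Lx.
Qed.

(** A loop at [K] is a word [x] such that [K ++ x ++ K] is in the language. Loops can
    be concatenated, with a copy of [K] in between. The set below measures how little
    the element represented by the loop [x] remembers of the last letter of [x]. *)
Definition last_letters x : {set Q} :=
  [set p | `[< exists w, [/\ L (K ++ rcons w p ++ K),
                            act (rcons w p) =1 act x & (size w).+1 = size x] >]].

Lemma last_lettersP x p :
  reflect (exists w, [/\ L (K ++ rcons w p ++ K),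
             act (rcons w p) =1 act x & (size w).+1 = size x])
          (p \in last_letters x).
Proof. by rewrite inE; exact: asboolP. Qed.

(** Each factor of the product [y ++ x ++ K] reads the image of the letters under the
    factors on its right. *)
Lemma loop_trans y x y' x' : size y = k -> size y' = k -> size x = size x' ->
  L (y ++ x ++ K) -> L (y' ++ x' ++ K) -> exists u,
    [/\ sect K u = K, sect x (act K u) = x' & sect y (act x (act K u)) = y'].
Proof.
move=> ky ky' sx Lx Lx'; have [|u] := power_orbit_trans _ Lx Lx'.
  by rewrite !size_cat sx ky ky'.
rewrite !sect_cat_l !act_cat_l => /eqP.
rewrite eqseq_cat ?size_sect ?ky ?ky' // => /andP[/eqP eL].
rewrite eqseq_cat ?size_sect // => /andP[/eqP eM /eqP eR].
by exists u.
Qed.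

Lemma loop_sect y w u : sect K u = K ->
  sect (y ++ w ++ K) u = sect y (act w (act K u)) ++ sect w (act K u) ++ K.
Proof. by move=> eK; rewrite !sect_cat_l !act_cat_l eK. Qed.

(** A transformation of the loop [x] into the loop [y] transforms all loops equal to
    [x] in the semigroup, with the same effect on the surrounding copies of [K]. *)
Lemma card_last_letters_le x y : size x = size y ->
  L (K ++ x ++ K) -> L (K ++ y ++ K) -> #|last_letters x| <= #|last_letters y|.
Proof.
move=> sxy Lx Ly.
have [||u [uR ux uL]] := loop_trans _ _ sxy Lx Ly; rewrite ?size_nseq //.
rewrite -(card_imset _ (bij_inj (sect1_bij revM (act K u)))).
apply/subset_leq_card/fintype.subsetP => _ /imsetP[p /last_lettersP[w [Lw ew sw]] ->].
have er : rcons (sect w (act [:: p] (act K u))) (sect1 p (act K u))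
          = sect (rcons w p) (act K u).
  by rewrite -!cats1 sect_cat_l.
apply/last_lettersP; exists (sect w (act [:: p] (act K u))).
rewrite size_sect sw er -ux; split; last by rewrite size_sect.
  by have := power_orbit_sect u Lw; rewrite loop_sect // ew uL.
exact: (eq_act_sect _ ew).
Qed.

Lemma card_last_letters x y : size x = size y ->
  L (K ++ x ++ K) -> L (K ++ y ++ K) -> #|last_letters x| = #|last_letters y|.
Proof.
by move=> s Lx Ly; apply/eqP; rewrite eqn_leq !card_last_letters_le.
Qed.

Lemma loop_glue x z :
  L (K ++ z ++ K) -> L (K ++ x ++ K) -> L (K ++ (z ++ K ++ x) ++ K).
Proof.
by move=> Lz Lx; rewrite -!catA catA; apply: power_orbit_glueK; rewrite -?catA.
Qed.

Lemma last_letters_glue x z : L (K ++ z ++ K) ->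
  last_letters x \subset last_letters (z ++ K ++ x).
Proof.
move=> Lz; apply/fintype.subsetP => p /last_lettersP[w [Lw ew sw]].
apply/last_lettersP; exists (z ++ K ++ w); rewrite !rcons_cat; split.
- exact: loop_glue.
- by do 2![apply: eq_act_cat => //].
- by rewrite !size_cat -sw !addnS.
Qed.

Lemma power_loop n : L (K ++ nseq n q ++ K).
Proof. by rewrite -!nseqD; exact: power_orbit_nseq. Qed.

(** A loop can be prolonged by [q] on its left, because [q :: K = rcons K q]. *)
Lemma last_letters_nseq_mono m n : m <= n ->
  last_letters (nseq m q) \subset last_letters (nseq n q).
Proof.
move=> /subnKC <-; elim: (n - m) => [|i IHi]; first by rewrite addn0.
apply: (fintype.subset_trans IHi); rewrite addnS.
apply/fintype.subsetP => p /last_lettersP[w [Lw ew sw]].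
apply/last_lettersP; exists (q :: w); rewrite rcons_cons; split.
- exact: power_orbit_consK.
- exact: (@eq_act_cat _ [:: q] [:: q]).
- by rewrite /= sw.
Qed.

Section Bounded.
Variable N : nat.
Hypothesis full : left_ext K \subset last_letters (nseq N q).

(** Carry [K ++ q ^ (size x) ++ K] to the given word: the letter that goes to [q] is a left
    extension of [K], hence the last letter of a loop representing the same power;
    the image of that loop represents [x] and ends in [q]. *)
Lemma loop_peel y x : size y = k -> N <= size x -> 0 < size x ->
  L (y ++ x ++ K) ->
  exists x', [/\ (size x').+1 = size x, L (y ++ x' ++ K) &
                 act x =1 act (rcons x' q)].
Proof.
move=> ky Nx x0 Lx; set m := size x in Nx x0 *.
have [||u [uR ux uL]] := loop_trans _ ky _ (power_loop m) Lx;
  rewrite ?size_nseq //.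
have [p ep] : exists p, sect1 p (act K u) = q.
  by have [g _ gK] := sect1_bij revM (act K u); exists (g q).
have pK : p \in left_ext K.
  apply/left_extP/(power_orbit_sect_inv (u := u)).
  by rewrite /= ep uR; exact: (power_orbit_nseq k.+1).
have := fintype.subsetP (last_letters_nseq_mono Nx) _ (fintype.subsetP full _ pK).
case/last_lettersP => w [Lw ew sw].
exists (sect w (act [:: p] (act K u))).
have er : rcons (sect w (act [:: p] (act K u))) q
          = sect (rcons w p) (act K u).
  by rewrite -!cats1 sect_cat_l /= ep.
rewrite size_sect sw size_nseq; split=> //.
  have := power_orbit_sect u Lw.
  rewrite loop_sect // ew uL -er -cats1 -!catA /= -rcons_nseq -cats1.
  by rewrite !catA => /power_orbit_cat[].
by rewrite er -ux; apply: eq_act_sect => v; rewrite ew.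
Qed.

Lemma loop_peel_all y x n : size y = k -> size x = N + n ->
  L (y ++ x ++ K) -> exists z : N.-tuple Q, act x =1 act (z ++ nseq n q).
Proof.
move=> ky; elim: n x => [|n IHn] x sx Lx.
  rewrite addn0 in sx; exists (tcast sx (in_tuple x)).
  by rewrite val_tcast cats0.
have [||x' [sx' Lx' ex']] := loop_peel ky _ _ Lx; rewrite ?sx ?leq_addr ?addnS //.
have [|z ez] := IHn x' _ Lx'; first by apply: succn_inj; rewrite sx' sx addnS.
have eq1 : nseq n.+1 q = nseq n q ++ [:: q] by rewrite cats1 rcons_nseq.
exists z => v; rewrite ex' eq1 catA -cats1.
exact: eq_act_cat.
Qed.

(** Peeling leaves a word of length [N] times a power of [q]. To have a loop to peel,
    first carry the word [s] of length [k] that follows to [K]; so the finite data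
    are [s] and the peeled word. *)
Lemma power_orbit_cover : exists psi : nat -> k.-tuple Q * N.-tuple Q -> seq Q,
  forall n u, exists i, act (sect (nseq (N + n) q) u) =1 act (psi n i).
Proof.
have sR (s : k.-tuple Q) : exists u, L s -> sect K u = s.
  case: (pselect (L s)) => [Ls|nLs]; last by exists [::].
  have [|u eu] := power_orbit_trans _ (power_orbit_nseq k) Ls.
    by rewrite size_nseq size_tuple.
  by exists u.
have [r rP] := choice sR.
(* For [s] in the language [r s] carries [K] to [s], so
   [act K (r s)] is read by the loop preceding [K]. *)
exists (fun n (sz : k.-tuple Q * N.-tuple Q) =>
  sect (sz.2 ++ nseq n q) (act K (r sz.1))) => n u.
have [u0 eu0] := act_surj invM K u.
have szs : size (sect K u0) == k by rewrite size_sect size_nseq.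
pose s := Tuple szs; set x := sect _ u.
have Lyx : L (sect K (act (nseq (N + n) q) u) ++ x ++ s).
  have := power_orbit_sect u0 (power_loop (N + n)).
  by rewrite !sect_cat_l !act_cat_l eu0.
have Ls : L s by have [_ /power_orbit_cat[]] := power_orbit_cat Lyx.
have eK := rP s Ls; set v := r s in eK.
have [x1 ex1] := sect_surj revM x (act K v).
have [y1 ey1] :=
  sect_surj revM (sect K (act (nseq (N + n) q) u)) (act x1 (act K v)).
have Lx1 : L (y1 ++ x1 ++ K).
  apply: (power_orbit_sect_inv (u := v)).
  by rewrite !sect_cat_l !act_cat_l ex1 ey1 eK.
have sy1 : size y1 = k.
  by rewrite -(size_sect y1 (act x1 (act K v))) ey1 size_sect size_nseq.
have sx1 : size x1 = N + n.
  by rewrite -(size_sect x1 (act K v)) ex1 size_sect size_nseq.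
have [z ez] := loop_peel_all sy1 sx1 Lx1.
by exists (s, z) => w; rewrite -ex1; apply: eq_act_sect.
Qed.

End Bounded.

End Markov.
End OrbitLanguage.

(** * Automata with finitely many states up to equality *)

Section Pigeonhole.
Variable M : mealy.

Lemma act_cons_head (s t : seq (state M)) a u :
  ohead (act s [:: a]) = ohead (act t [:: a]) ->
  act (sect s [:: a]) u = act (sect t [:: a]) u ->
  act s (a :: u) = act t (a :: u).
Proof.
move=> eh et; rewrite -cat1s !act_cat_r et; congr (_ ++ _).
move: (size_act s [:: a]) (size_act t [:: a]) eh.
by case: (act s _) (act t _) => [|x []] // [|y []] //= _ _ [->].
Qed.

(** If the orbits of the words [r n] are covered by families with a common finite
    index set, then each [r n] acts as a state of a Mealy automaton on that set;
    there are finitely many of these. *)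
Lemma covered_orbit_repeat (I : finType) (psi : nat -> I -> seq (state M))
    (r : nat -> seq (state M)) :
  (forall n u, exists i, act (sect (r n) u) =1 act (psi n i)) ->
  exists m n, m < n /\ act (r m) =1 act (r n).
Proof.
move=> cov.
pose orb n i u := act (sect (r n) u) =1 act (psi n i).
have tabP n : exists t : I * {ffun I * letter M -> I * option (letter M)},
    orb n t.1 [::] /\ forall i u a, orb n i u ->
      orb n (t.2 (i, a)).1 (rcons u a) /\
      (t.2 (i, a)).2 = ohead (act (psi n i) [:: a]).
  have [i0 e0] := cov n [::].
  (* The transition at [i] is only constrained when [i] represents a point of the
     orbit; elsewhere any value will do. *)
  have stepP (ia : I * letter M) : exists j,
      forall u, orb n ia.1 u -> orb n j (rcons u ia.2).
    case: ia => i a /=.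
    have [[u ou]|no] := pselect (exists u, orb n i u); last first.
      by exists i => u ou; case: no; exists u.
    have [j ej] := cov n (rcons u a); exists j => v ov w.
    rewrite -ej -!cats1 !sect_cat_r.
    apply: eq_act_sect => {}w; by rewrite ov ou.
  have [f fP] := choice stepP.
  exists (i0, [ffun ia => (f ia, ohead (act (psi n ia.1) [:: ia.2]))]).
  by split=> // i u a ou; rewrite ffunE /=; split=> //; exact: fP (i, a) _ ou.
have [t tP] := choice tabP.
pose T : finType := (I * {ffun I * letter M -> I * option (letter M)})%type.
have /injectivePn[x [y nxy exy]] : ~~ injectiveb (fun i : 'I_#|T|.+1 => t i).
  apply/injectiveP => /leq_card; rewrite card_ord.
  by rewrite ltnn.
have agree m n : t m = t n -> act (r m) =1 act (r n).
  move=> et.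
  have [om sm] := tP m; have [on sn] := tP n; rewrite -et in on sn.
  have main u i v v' : orb m i v -> orb n i v' ->
      act (psi m i) u = act (psi n i) u.
    elim: u i v v' => [|a u IHu] i v v' ov ov'; first by rewrite !act_nil_r.
    have [om' hm] := sm _ _ a ov; have [on' hn] := sn _ _ a ov'.
    apply: act_cons_head; first by rewrite -hm hn.
    have := IHu _ _ _ om' on'; rewrite -om' -on' -!cats1 !sect_cat_r.
    by rewrite (eq_act_sect _ ov) (eq_act_sect _ ov').
  move=> u; have := main u _ _ _ om on.
  by rewrite -om -on !sect_nil_r.
have [xy|yx|exy'] := ltngtP x y.
- by exists x, y; split=> //; exact: agree.
- by exists y, x; split=> //; apply: agree.
- by rewrite (val_inj exy') eqxx in nxy.
Qed.

End Pigeonhole.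

(** * Free monoids from states of infinite order *)

Section FreeBlocks.
Variables (M : mealy) (invM : invertible M) (revM : reversible M).
Variable q : state M.
Local Notation Q := (state M).
Local Notation L := (power_orbit q).
Implicit Types (bs cs : seq bool).

Lemma act_nseq_return n u : exists i, n <= i /\ act (nseq i q) u = u.
Proof.
have szP (x : (size u).-tuple (letter M)) : size (act [:: q] x) == size u.
  by rewrite size_act size_tuple.
pose f x := Tuple (szP x).
have fI : injective f by move=> x y /(congr1 val) /(act_inj invM) /val_inj.
have itf i x : val (iter i f x) = act (nseq i q) x.
  by elim: i => [|i IHi] //=; rewrite IHi.
pose x0 := in_tuple u; exists (n * order f x0); split.
  by rewrite leq_pmulr ?order_gt0.
suff e : iter (n * order f x0) f x0 = x0 by rewrite -[u]/(val x0) -itf e.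
by elim: n => [|n IHn] //=; rewrite mulSn iterD IHn iter_order.
Qed.

(** The letters of [sect (q ^ n) u], read from the right, are the values of
    [sect1 q] along the trajectory of [u] under the permutation [act [:: q]] of the
    words of its length. So they form a periodic sequence, and its initial block
    recurs. *)
Lemma power_orbit_recurrent x : L x -> exists w, L (x ++ w ++ x).
Proof.
case=> u eu; have [i [xi ei]] := act_nseq_return (size x) u.
exists (sect (nseq (i - size x) q) (act (nseq (size x) q) u)).
suff <- : sect (nseq (size x + i) q) u
    = x ++ sect (nseq (i - size x) q) (act (nseq (size x) q) u) ++ x.
  exact: power_orbit_sect (power_orbit_nseq q _).
rewrite nseqD sect_cat_l ei eu; congr (_ ++ _).
by rewrite -{1}(subnK xi) nseqD sect_cat_l eu.
Qed.

Variable k : nat.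
Hypothesis kstable : forall n, k <= n ->
  #|left_ext q (nseq n q)| = #|left_ext q (nseq k q)|.
Local Notation K := (nseq k q).

Lemma power_orbit_loop_back p :
  p \in left_ext q K -> exists w, L (K ++ rcons w p ++ K).
Proof.
move/left_extP => /power_orbit_recurrent[w]; rewrite -cat1s -!catA.
by move=> /power_orbit_cat[_ Lw]; exists w; rewrite cat_rcons.
Qed.

Lemma power_orbit_consnK n x : L (K ++ x) -> L (K ++ nseq n q ++ x).
Proof. by move=> Lx; elim: n => //= n; exact: power_orbit_consK. Qed.

Section Blocks.
Variables x0 y0 : seq Q.
Hypotheses (Lx0 : L (K ++ x0 ++ K)) (Ly0 : L (K ++ y0 ++ K)).

(** The leading [K] makes any sequence of blocks a word of the language. *)
Definition block (c : bool) : seq Q := K ++ if c then x0 else y0.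
Definition block_word bs : seq Q := flatten (map block bs).

Lemma block_word_prefix bs : exists z, block_word bs ++ K = K ++ z.
Proof.
case: bs => [|c bs]; first by exists [::]; rewrite cats0.
by rewrite /block_word /= -!catA; eexists.
Qed.

Lemma block_wordP bs : L (block_word bs ++ K).
Proof.
elim: bs => [|c bs IHbs]; first exact: power_orbit_nseq.
have [z ez] := block_word_prefix bs.
rewrite /block_word /= -/(block_word bs) -catA ez.
rewrite ez in IHbs; apply: power_orbit_glueK => //.
by rewrite /block; case: c; rewrite -catA.
Qed.

Lemma block_word_loop bs : L (K ++ block_word bs ++ K).
Proof.
have Lb := block_wordP bs.
have [z ez] := block_word_prefix bs.
rewrite ez in Lb *; apply: power_orbit_glueK => //.
by rewrite -nseqD; exact: power_orbit_nseq.
Qed.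

Lemma block_word_rcons bs c :
  block_word (rcons bs c) = block_word bs ++ K ++ if c then x0 else y0.
Proof. by rewrite /block_word map_rcons flatten_rcons. Qed.

Lemma size_block_word bs : size x0 = size y0 ->
  size (block_word bs) = size bs * (k + size y0).
Proof.
move=> sxy; elim: bs => //= c bs IHbs; rewrite /block_word /= size_cat.
rewrite -/(block_word bs) IHbs mulSn /block size_cat size_nseq.
by case: c; rewrite ?sxy.
Qed.

Hypothesis sxy : size x0 = size y0.
Hypothesis max_last : forall n, size y0 <= n ->
  #|last_letters q k (nseq n q)| = #|last_letters q k (nseq (size y0) q)|.
Hypothesis sep : last_letters q k x0 <> last_letters q k y0.

(** Putting a loop on the left of a long enough loop does not change its set of
    last letters, because that set cannot grow any more. *)
Lemma last_letters_block bs x : size x = size y0 -> L (K ++ x ++ K) ->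
  last_letters q k (block_word bs ++ K ++ x) = last_letters q k x.
Proof.
move=> sx Lx; apply/esym/eqP; rewrite eqEcard.
rewrite (last_letters_glue revM kstable x (block_word_loop bs)) /=.
have cardE z : L (K ++ z ++ K) ->
    #|last_letters q k z| = #|last_letters q k (nseq (size z) q)|.
  move=> Lz; apply: card_last_letters => //; first by rewrite size_nseq.
  exact: power_loop.
rewrite (cardE _ (loop_glue revM kstable (block_word_loop bs) Lx)) (cardE _ Lx) sx.
rewrite max_last // !size_cat sx.
by rewrite addnA leq_addl.
Qed.

Lemma eq_last_letters x y : size x = size y -> act x =1 act y ->
  last_letters q k x = last_letters q k y.
Proof.
move=> s e; apply/setP => p; apply/last_lettersP/last_lettersP => -[w [Lw ew sw]].
  by exists w; split=> // [v|]; rewrite ?ew ?e ?sw.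
by exists w; split=> // [v|]; rewrite ?ew ?e ?sw.
Qed.

(** Among words of a given length the set of last letters is determined by the
    element, and it tells which block comes last. *)
Lemma block_word_sep bs cs : size bs = size cs ->
  ~ act (block_word (rcons bs true)) =1 act (block_word (rcons cs false)).
Proof.
move=> sbc; rewrite !block_word_rcons => /eq_last_letters e; apply: sep.
rewrite -(last_letters_block bs sxy) // -(last_letters_block cs (x := y0)) //.
by apply: e; rewrite !size_cat !size_block_word // sbc sxy.
Qed.

Lemma block_word_inj bs cs : size bs = size cs ->
  act (block_word bs) =1 act (block_word cs) -> bs = cs.
Proof.
elim/last_ind: bs cs => [|bs b IHbs] cs; first by case: cs.
case/lastP: cs => [|cs c]; first by rewrite size_rcons.
rewrite !size_rcons => -[sbc]; case: b c => [] [] e.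
- by rewrite (IHbs cs sbc) //; move: e; rewrite !block_word_rcons;
     exact: eq_act_cat2r.
- by case: (block_word_sep sbc e).
- by case: (@block_word_sep cs bs) => // u; rewrite e.
- by rewrite (IHbs cs sbc) //; move: e; rewrite !block_word_rcons;
     exact: eq_act_cat2r.
Qed.

End Blocks.

Lemma last_letters_stable : exists N, forall n, N <= n ->
  #|last_letters q k (nseq n q)| = #|last_letters q k (nseq N q)|.
Proof.
pose P d := `[< exists N, #|last_letters q k (nseq N q)| = d >].
have exP : exists d, P d.
  by exists #|last_letters q k (nseq 0 q)|; apply/asboolP; exists 0.
have [|_ /asboolP[N <-] maxd] := ex_maxnP exP (m := #|Q|).
  by move=> _ /asboolP[N <-]; exact: max_card.
exists N => n Nn; apply/eqP; rewrite eqn_leq maxd /=; last first.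
  by apply/asboolP; exists n.
exact: subset_leq_card (last_letters_nseq_mono revM kstable Nn).
Qed.

Hypothesis infq : forall n, 0 < n -> ~ act (nseq n q) =1 id.

(** Otherwise the orbits of all powers of [q] would be covered by families with the
    same finite index set, two powers would coincide, and [q] would have finite
    order. *)
Lemma exists_missing_letter :
  exists2 p, p \in left_ext q K & forall n, p \notin last_letters q k (nseq n q).
Proof.
apply: contrapT => none.
have fullP p : exists n, p \in left_ext q K -> p \in last_letters q k (nseq n q).
  apply: contrapT => no; apply: none; exists p.
    by apply: contrapT => /negP np; apply: no; exists 0; rewrite (negPf np).
  by move=> n; apply/negP => pn; apply: no; exists n.
have [f fP] := choice fullP.
have full : left_ext q K \subset last_letters q k (nseq (\max_p f p) q).
  apply/fintype.subsetP => p /fP; apply: fintype.subsetP.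
  exact: (last_letters_nseq_mono revM kstable) (leq_bigmax p).
have [psi psiP] := power_orbit_cover invM revM kstable full.
have [m [n [mn e]]] := covered_orbit_repeat psiP.
move: e; set N := \max_p f p => e.
apply: (infq (n := n - m)) => [|u]; first by rewrite subn_gt0.
apply: (act_inj invM (s := nseq (N + m) q)).
by rewrite -act_cat_l -nseqD -addnA subnKC ?(ltnW mn) // -e.
Qed.

(** The missing letter [p] ends a loop, by recurrence. That loop and the power of [q]
    of the same length have different sets of last letters, and the power [q ^ N]
    put in front makes both long enough for these sets to be stable. *)
Lemma free_blocks_stable : exists B : bool -> seq Q, forall bs cs,
  size bs = size cs ->
  act (flatten (map B bs)) =1 act (flatten (map B cs)) -> bs = cs.
Proof.
have [p pK pN] := exists_missing_letter.
have [w Lw] := power_orbit_loop_back pK.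
have [N maxN] := last_letters_stable.
pose y0 := nseq N q ++ rcons w p.
have Ly0 : L (K ++ y0 ++ K) by rewrite -catA; exact: power_orbit_consnK.
have Ny : N <= size y0 by rewrite size_cat size_nseq leq_addr.
exists (block (nseq (size y0) q) y0) => bs cs sbc.
apply: (block_word_inj (power_loop q k _) Ly0) => //.
- by rewrite size_nseq.
- by move=> n yn; rewrite !maxN // (leq_trans Ny).
move/setP/(_ p); rewrite (negPf (pN _)) => /esym/negP; apply; apply/last_lettersP.
exists (nseq N q ++ w); split; rewrite ?rcons_cat //.
by rewrite /y0 !size_cat size_rcons addnS.
Qed.

End FreeBlocks.

Theorem free_blocks (M : mealy) (q : state M) :
  invertible M -> reversible M ->
  (forall n, 0 < n -> ~ act (nseq n q) =1 id) ->
  exists B : bool -> seq (state M), forall bs cs, size bs = size cs ->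
    act (flatten (map B bs)) =1 act (flatten (map B cs)) -> bs = cs.
Proof.
move=> invM revM infq; have [k kP] := left_ext_stable q.
exact: (free_blocks_stable invM revM kP infq).
Qed.

(** * From states to words *)

(** The words of length [l] are the states of an automaton on the same alphabet; this
    reduces words of infinite order to single states of infinite order. *)
Section PowerAutomaton.
Variables (M : mealy) (l : nat).
Local Notation Q := (state M).

Lemma sect_tupleP (t : l.-tuple Q) u : size (sect t u) == l.
Proof. by rewrite size_sect size_tuple. Qed.

Definition power_automaton : mealy :=
  @Mealy (l.-tuple Q : finType) (letter M) (fun ta =>
    (head ta.2 (act ta.1 [:: ta.2]), Tuple (sect_tupleP ta.1 [:: ta.2]))).

Lemma act_single (s : seq Q) a : act s [:: a] = [:: head a (act s [:: a])].
Proof. by have := size_act s [:: a]; case: (act s [:: a]) => [|b []]. Qed.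

Lemma act1_power (t : state power_automaton) u : act1 t u = act (val t) u.
Proof.
elim: u t => [|a u IHu] t /=; first by rewrite act_nil_r.
rewrite IHu -[a :: u]cat1s act_cat_r [in RHS]act_single.
by [].
Qed.

Lemma act_power (ts : seq (state power_automaton)) u :
  act ts u = act (flatten (map val ts)) u.
Proof. by elim: ts => //= t ts ->; rewrite act1_power act_cat_l. Qed.

Lemma invertible_power : invertible M -> invertible power_automaton.
Proof.
move=> invM t; apply: injF_bij => a b eab.
suff /(act_inj invM)[] : act (val t) [:: a] = act (val t) [:: b] by [].
by rewrite act_single [in RHS]act_single; congr [:: _].
Qed.

Lemma reversible_power : reversible M -> reversible power_automaton.
Proof.
move=> revM a; apply: injF_bij => s t /(congr1 val) /= est; apply: val_inj.
by apply: sect_inj est; rewrite ?size_tuple.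
Qed.

End PowerAutomaton.

Lemma free_blocks_word (M : mealy) (s : seq (state M)) :
  invertible M -> reversible M ->
  (forall n, 0 < n -> ~ act (flatten (nseq n s)) =1 id) ->
  exists B : bool -> seq (state M), forall bs cs, size bs = size cs ->
    act (flatten (map B bs)) =1 act (flatten (map B cs)) -> bs = cs.
Proof.
move=> invM revM infs.
pose N := power_automaton M (size s); pose t : state N := in_tuple s.
have infN n : 0 < n -> ~ act (nseq n t) =1 id.
  by move=> n0 tn; apply: (infs n n0) => u; have := tn u; rewrite act_power map_nseq.
have [B BP] := free_blocks (@invertible_power _ _ invM)
  (@reversible_power _ _ revM) infN.
have flatB bs : flatten (map (fun c => flatten (map val (B c))) bs)
    = flatten (map val (flatten (map B bs))).
  by elim: bs => //= b bs ->; rewrite map_cat flatten_cat.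
exists (fun c => flatten (map val (B c))) => bs cs sbc e; apply: BP => // u.
by have := e u; rewrite !flatB -!act_power.
Qed.

(** * Automaton groups *)

Local Open Scope group_scope.

(** In a group this says that [a] and [b] freely generate a free monoid: by
    cancellation, a relation between words of different lengths entails one between
    distinct words of equal length. *)
Definition free_pair (G : groupType) (a b : G) : Prop :=
  forall bs cs : seq bool, size bs = size cs ->
    \prod_(c <- bs) (if c then a else b) = \prod_(c <- cs) (if c then a else b) ->
    bs = cs.

Section AutomatonGroups.
Variables (M : mealy) (invM : invertible M) (G : groupType).
Variable f : {multiplicative automaton_group invM -> G}.
Hypothesis bij_f : bijective f.
Local Notation E := (enriched invM).

Definition word_elt (w : seq (state E)) : G := f (pi_word w : automaton_group invM).

Lemma word_elt_cat s t : word_elt (s ++ t) = word_elt s * word_elt t.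
Proof. by rewrite /word_elt -gmulfM; congr (f _); exact: pi_word_cat. Qed.

Lemma word_elt_nil : word_elt [::] = 1.
Proof. by apply: (@mulgI _ (word_elt [::])); rewrite -word_elt_cat mulg1. Qed.

Lemma eq_word_elt s t : act s =1 act t -> word_elt s = word_elt t.
Proof. by move=> st; congr (f _); apply/eqP/pi_wordP. Qed.

Lemma word_elt_inj s t : word_elt s = word_elt t -> act s =1 act t.
Proof. by move=> /(bij_inj bij_f) /eqP /pi_wordP. Qed.

Lemma word_elt_surj (g : G) : exists w, word_elt w = g.
Proof.
have [h _ hK] := bij_f; exists (repr (h g : automaton_monoid E)).
by rewrite /word_elt pi_word_repr hK.
Qed.

Lemma word_elt_flatten ss : word_elt (flatten ss) = \prod_(s <- ss) word_elt s.
Proof.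
elim: ss => [|s ss IHss] /=; first by rewrite big_nil word_elt_nil.
by rewrite big_cons word_elt_cat IHss.
Qed.

Lemma act1_positive q u : act1 (inl q : state E) u = act1 q u.
Proof. by elim: u q => //= a u IHu q; rewrite -IHu. Qed.

Lemma act_positive (s : seq (state M)) u :
  act (map inl s : seq (state E)) u = act s u.
Proof. by elim: s => //= q s ->; rewrite act1_positive. Qed.

(** If the positive words all have finite order, then the inverse of a generator
    is a positive power of it, so every element is represented by a positive
    word. *)
Lemma positive_infinite_order (g : G) : infinite_order g ->
  exists s : seq (state M), forall n, (0 < n)%N -> ~ act (flatten (nseq n s)) =1 id.
Proof.
move=> infg; apply: contrapT => none.
have tors (s : seq (state M)) : exists2 n, (0 < n)%N & act (flatten (nseq n s)) =1 id.
  apply: contrapT => no; apply: none; exists s => n n0 e; apply: no.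
  by exists n.
have pos (w : seq (state E)) : exists s : seq (state M), act w =1 act s.
  elim: w => [|[q|q] w [s es]]; first by exists [::].
    by exists (q :: s) => u /=; rewrite es -act1_positive.
  have [[|n] // _ en] := tors [:: q].
  exists (flatten (nseq n [:: q]) ++ s) => u; rewrite act_cat_l /= es.
  set v := act s u; rewrite -[v in LHS]en /= -act1_positive.
  exact: (act1_flip (inl q : state E)).
have [w ew] := word_elt_surj g; have [s es] := pos w.
have [n n0 en] := tors s; apply: (infg n n0).
have eg : g = word_elt (map inl s).
  by rewrite -ew; apply: eq_word_elt => u; rewrite es act_positive.
have gX m : g ^+ m = word_elt (map inl (flatten (nseq m s))).
  elim: m => [|m IHm]; first by rewrite word_elt_nil.
  by rewrite expgS IHm {1}eg -word_elt_cat -map_cat.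
by rewrite gX -word_elt_nil; apply: eq_word_elt => u; rewrite act_positive en.
Qed.

Lemma automaton_free_pair (g : G) : reversible M -> infinite_order g ->
  exists a b : G, free_pair a b.
Proof.
move=> revM /positive_infinite_order[s infs].
have [B BP] := free_blocks_word invM revM infs.
pose a c := word_elt (map inl (B c)).
have prodE bs : \prod_(c <- bs) (if c then a true else a false)
    = word_elt (map inl (flatten (map B bs))).
  rewrite map_flatten word_elt_flatten -map_comp big_map.
  by apply: eq_bigr => -[].
exists (a true), (a false) => bs cs sbc; rewrite !prodE => /word_elt_inj e.
by apply: BP => // u; rewrite -!act_positive.
Qed.

End AutomatonGroups.

(** * Growth *)

Section Growth.
Variable G : groupType.
Implicit Types (S : set G) (a b g x y : G).

Lemma ball_mul S m n x y : ball S m x -> ball S n y -> ball S (m + n) (x * y).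
Proof.
move=> [v [sv Sv ->]] [w [sw Sw ->]]; exists (v ++ w).
rewrite size_cat leq_add // big_cat; split=> // z.
by rewrite mem_cat => /orP[/Sv|/Sw].
Qed.

Lemma ball_le S m n x : (m <= n)%N -> ball S m x -> ball S n x.
Proof. by move=> mn [w [sw Sw ->]]; exists w; split=> //; exact: leq_trans mn. Qed.

Lemma ball_prod S n (xs : seq G) : (forall x, x \in xs -> ball S n x) ->
  ball S (size xs * n) (\prod_(x <- xs) x).
Proof.
elim: xs => [|x xs IHxs] Sxs; first by exists [::]; rewrite big_nil.
rewrite big_cons mulSn; apply: ball_mul; first exact/Sxs/mem_head.
by apply: IHxs => z zxs; apply: Sxs; rewrite inE zxs orbT.
Qed.

Lemma mem_ball S n g : finite_set S ->
  (g \in fset_set (ball S n)) = `[< ball S n g >].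
Proof.
move=> fS; rewrite in_fset_set; last exact: finite_ball.
by apply/idP/asboolP => [/set_mem|/mem_set].
Qed.

Lemma growthD S m n : finite_set S ->
  (growth S (m + n) <= growth S m * growth S n)%N.
Proof.
move=> fS; rewrite /growth.
rewrite -(size_allpairs (fun x y : G => x * y)); apply: uniq_leq_size; first exact: fset_uniq.
move=> g; rewrite mem_ball // => /asboolP[w [sw Sw ->]].
rewrite -(cat_take_drop m w) big_cat.
apply: allpairs_f; rewrite mem_ball //; apply/asboolP.
  exists (take m w); split=> //; first by rewrite size_take; case: ltnP.
  by move=> x /mem_take /Sw.
exists (drop m w); split=> //; first by rewrite size_drop leq_subLR.
by move=> x /mem_drop /Sw.
Qed.

Lemma growthM S l n : finite_set S -> (growth S (l * n) <= growth S n ^ l)%N.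
Proof.
move=> fS; elim: l => [|l IHl].
  rewrite mul0n expn0 /growth -[1%N]/(size [:: (1 : G)]).
  apply: uniq_leq_size; first exact: fset_uniq.
  move=> g; rewrite mem_ball // => /asboolP[w [+ _ ->]].
  by rewrite leqn0 size_eq0 => /eqP->; rewrite big_nil mem_head.
by rewrite mulSn expnS (leq_trans (growthD _ _ fS)) // leq_mul2l IHl orbT.
Qed.

Lemma growth_free_pair S l n a b : finite_set S -> free_pair a b ->
  ball S l a -> ball S l b -> (2 ^ n <= growth S (n * l))%N.
Proof.
move=> fS fab Sa Sb; pose v (t : n.-tuple bool) := \prod_(c <- t) (if c then a else b).
have vI : injective v.
  by move=> s t /fab e; apply: val_inj; apply: e; rewrite !size_tuple.
have -> : (2 ^ n)%N = size (map v (enum {: n.-tuple bool})).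
  by rewrite size_map -cardE card_tuple card_bool.
apply: uniq_leq_size; first by rewrite map_inj_uniq ?enum_uniq.
move=> _ /mapP[t _ ->]; rewrite mem_ball //; apply/asboolP.
rewrite /v -(big_map (fun c : bool => if c then a else b) xpredT id).
rewrite -{1}(size_tuple t) -(size_map (fun c : bool => if c then a else b)).
by apply: ball_prod => x /mapP[[] _ ->].
Qed.

Section RootOfTwo.
Import Order.TTheory GRing.Theory Num.Theory.
Local Open Scope ring_scope.

Lemma exists_root_le2 (R : realType) l : exists2 c : R, 1 < c & c ^+ l <= 2.
Proof.
pose x : R := 2 ^- l.
have x0 : 0 < x by rewrite invr_gt0 exprn_gt0.
have x1 : x <= 1 by rewrite invf_le1 ?exprn_gt0 // exprn_ege1 // ler1n.
(* The induction for [(1 + x) ^ m] with [x <= 1]; then take [x = 2 ^ - l]. *)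
have bound m : (1 + x) ^+ m <= 1 + (2 ^+ m - 1) * x.
  elim: m => [|m IHm]; first by rewrite !expr0 subrr mul0r addr0.
  have e0 : 0 <= 2 ^+ m - 1 :> R by rewrite subr_ge0 exprn_ege1 // ler1n.
  rewrite exprS (le_trans (ler_wpM2l _ IHm)) ?addr_ge0 ?(ltW x0) //.
  set e := 2 ^+ m - 1 in e0 *.
  have -> : 2 ^+ m.+1 - 1 = e + e + 1 :> R by rewrite exprS /e; ring.
  have e1 : e * x * x <= e * x by rewrite ler_piMr ?mulr_ge0 ?(ltW x0).
  rewrite -subr_ge0; suff -> : 1 + (e + e + 1) * x - (1 + x) * (1 + e * x) = e * x - e * x * x by rewrite subr_ge0.
  ring.
exists (1 + x); first by rewrite ltrDl.
rewrite (le_trans (bound l)) // mulrBl mul1r mulfV ?expf_neq0 ?pnatr_eq0 //.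
by rewrite addrA lerBlDr -[1 + 1]/(2 : R) lerDl ltW.
Qed.

(** If [a] and [b] lie in the ball of radius [l], then
    [2 ^ n <= growth S (n * l) <= growth S n ^ l], so any [c] with [c ^ l <= 2] is a
    growth rate. *)
Lemma free_pair_exponential_growth (R : realType) a b :
  (exists S, finite_set S /\ generating S) -> free_pair a b ->
  exponential_growth G R.
Proof.
move=> fg fab; split=> // S fS genS.
have [la Sa] := genS a; have [lb Sb] := genS b.
pose l := (la + lb).+1.
have {}Sa : ball S l a by apply: ball_le Sa; rewrite leqW ?leq_addr.
have {}Sb : ball S l b by apply: ball_le Sb; rewrite leqW ?leq_addl.
have [c c1 cl] := exists_root_le2 R l; exists c; split=> // n.
have c0 : 0 <= c by rewrite ltW // (lt_trans ltr01).
rewrite -(@ler_pXn2r _ l) ?nnegrE ?exprn_ge0 // -exprM mulnC exprM.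
rewrite (le_trans (lerXn2r n _ _ cl)) ?nnegrE ?exprn_ge0 // -!natrX ler_nat.
by rewrite (leq_trans (growth_free_pair n fS fab Sa Sb)) // mulnC growthM.
Qed.
End RootOfTwo.
End Growth.

(** * The upper central series *)

Section Nilpotent.
Variables (G : groupType) (H : set G).
Hypothesis sgH : is_subgroup H.
Implicit Types (x y z g : G) (K : set G).

Lemma is_subgroupP K : is_subgroup K <->
  [/\ K 1, forall x y, K x -> K y -> K (x * y) & forall x, K x -> K x^-1].
Proof.
split=> [sK|[K1 KM KV]].
  have [/set_mem K1 _] := sK; split=> // [x y /mem_set Kx /mem_set Ky|x /mem_set Kx].
    by apply/set_mem; exact: (group_closedM sK).
  by apply/set_mem; exact: (group_closedV sK).
split=> [|x y /set_mem Kx /set_mem Ky]; first exact/mem_set.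
by apply/mem_set; apply: KM => //; exact: KV.
Qed.

Lemma upper_central_sub n x : upper_central H n x -> H x.
Proof. by case: n => [->|n []] //; have [] := (is_subgroupP H).1 sgH. Qed.

Lemma upper_central_conj n x y :
  upper_central H n x -> H y -> upper_central H n (x ^ y).
Proof.
have [H1 HM HV] := (is_subgroupP H).1 sgH.
have HJ u v : H u -> H v -> H (u ^ v).
  by move=> Hu Hv; rewrite conjgE; apply: (HM); [exact: HV | exact: HM].
elim: n x y => [|n IHn] x y /=; first by move=> ->; rewrite conj1g.
move=> [Hx Zx] Hy; split=> [|z Hz]; first exact: HJ.
have -> : [~ x ^ y, z] = [~ x, z ^ y^-1] ^ y by rewrite conjRg conjgKV.
by apply: IHn => //; apply: Zx; apply: HJ => //; exact: HV.
Qed.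

Lemma upper_central_subgroup n : is_subgroup (upper_central H n).
Proof.
have [H1 HM HV] := (is_subgroupP H).1 sgH.
elim: n => [|n /is_subgroupP[Z1 ZM ZV]]; apply/is_subgroupP.
  by split=> //= [x y -> ->|x ->]; rewrite ?mulg1 ?invg1.
split=> /=.
- by split=> // y _; rewrite comm1g.
- move=> x y [Hx Zx] [Hy Zy]; split=> [|z Hz]; first exact: HM.
  have -> : [~ x * y, z] = [~ x, z] ^ y * [~ y, z].
    by rewrite !commgEl !conjgE !invgM !mulgA !mulgK.
  by apply: ZM; [apply: upper_central_conj => //; exact: Zx | exact: Zy].
- move=> x [Hx Zx]; split=> [|y Hy]; first exact: HV.
  have -> : [~ x^-1, y] = ([~ x, y]^-1) ^ x^-1.
    by rewrite invgR !commgEl !conjgE !invgK !mulgA mulgK.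
  by apply: upper_central_conj; [apply: ZV; exact: Zx | exact: HV].
Qed.

End Nilpotent.

(** * Subgroups of finite index *)

Section FiniteTransversal.
Variable G : groupType.
Implicit Types (x y z g : G) (K : set G) (X T : seq G).

(** Finite index, with representatives that may repeat. *)
Definition finite_transversal K : Prop :=
  exists X, forall g, exists x, x \in X /\ K (x^-1 * g).

Lemma finite_index_transversal K : is_subgroup K -> finite_index K -> finite_transversal K.
Proof.
move=> /is_subgroupP[K1 KM KV] /finite_fsetP[C eC].
have repP (A : set G) : exists x,
    range (fun g => [set g * h | h in K])%classic A ->
    A = [set x * h | h in K]%classic.
  have [[x _ <-]|no] :=
    pselect (range (fun g => [set g * h | h in K])%classic A).
    by exists x.
  by exists 1.
have [r rP] := choice repP.
exists [seq r A | A <- C] => g.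
have rA : range (fun g => [set g * h | h in K])%classic
    [set g * h | h in K]%classic.
  by exists g.
exists (r [set g * h | h in K]%classic); split.
  by apply: map_f; have : [set` C]%classic [set g * h | h in K]%classic by rewrite -eC.
have : [set g * h | h in K]%classic g by exists 1; rewrite ?mulg1.
by move: (rP _ rA); set x := r _ => -> [h Kh <-]; rewrite mulKg.
Qed.

(** Two powers of [g] lie in the same coset. *)
Lemma finite_transversal_expg K g : is_subgroup K -> finite_transversal K ->
  exists2 n, (0 < n)%N & K (g ^+ n).
Proof.
move=> /is_subgroupP[K1 KM KV] [X XP].
have [r rP] := choice (fun i : nat => XP (g ^+ i)).
have rX i : (index (r i) X < size X)%N by rewrite index_mem; have [] := rP i.
have /injectivePn[i [j nij /(congr1 val) /= eij]] :
    ~~ injectiveb (fun i : 'I_(size X).+1 => Ordinal (rX i)).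
  by apply/injectiveP => /leq_card; rewrite !card_ord ltnn.
have pos m n : (m < n)%N -> r m = r n -> exists2 n, (0 < n)%N & K (g ^+ n).
  move=> mn rmn; exists (n - m)%N; first by rewrite subn_gt0.
  have [_ Km] := rP m; have [_ Kn] := rP n.
  have := KM _ _ (KV _ Km) Kn; rewrite invgM invgK rmn mulgA mulgK.
  by rewrite -{1}(subnKC (ltnW mn)) expgnDr mulKg.
have {}eij : r i = r j.
  have [rI _] := rP i; have [rJ _] := rP j.
  by rewrite -(nth_index 1 rI) eij nth_index.
have [ij|ji|/val_inj e] := ltngtP i j; [exact: pos ij _|exact: pos ji _|].
by rewrite e eqxx in nij.
Qed.

Definition monoid_generates T K : Prop :=
  forall g, K g -> exists2 w : seq G, {subset w <= T} & g = \prod_(x <- w) x.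

(** Schreier's lemma, for generation as a monoid. *)
Lemma schreier T K : is_subgroup K -> finite_transversal K ->
  monoid_generates T setT ->
  exists T', (forall t, t \in T' -> K t) /\ monoid_generates T' K.
Proof.
move=> /is_subgroupP[K1 KM KV] [X XP] genT.
have [r rP] := choice XP.
(* [1] starts the induction that moves the representative to the left; at the end
   the remaining representative lies in [K] and is counted as a generator. *)
pose X1 := 1 :: X.
pose T' := [seq (r (t * x))^-1 * (t * x) | t <- T, x <- X1]
           ++ [seq x <- X1 | `[< K x >]].
have KT' t : t \in T' -> K t.
  rewrite mem_cat => /orP[/allpairsP[[s x] [_ _ ->]]|].
    by have [] := rP (s * x).
  by rewrite mem_filter => /andP[/asboolP].
exists T'; split=> // g Kg; have [w wT eg] := genT g I.
have [x xX [v vT ew]] : exists2 x, x \in X1 &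
    exists2 v : seq G, {subset v <= T'} & \prod_(y <- w) y = x * \prod_(y <- v) y.
  elim: w wT {eg} => [|t w IHw] wT.
    by exists 1; [exact: mem_head | exists [::]; rewrite ?big_nil ?mulg1].
  have [|x xX [v vT ew]] := IHw; first by move=> z zw; apply: wT; rewrite inE zw orbT.
  have [rX _] := rP (t * x).
  exists (r (t * x)); first by rewrite inE rX orbT.
  exists ((r (t * x))^-1 * (t * x) :: v); last first.
    by rewrite !big_cons ew [in RHS]mulgA mulVKg mulgA.
  move=> z; rewrite inE => /orP[/eqP->|/vT//].
  rewrite mem_cat; apply/orP; left; apply/allpairsP; exists (t, x).
  by split=> //=; exact/wT/mem_head.
exists (x :: v); last by rewrite big_cons eg.
move=> z; rewrite inE => /orP[/eqP->|/vT//].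
rewrite mem_cat mem_filter xX andbT; apply/orP; right; apply/asboolP.
have Kv : K (\prod_(y <- v) y).
  elim: (v) vT => [|y v' IHv] v'T; first by rewrite big_nil.
  rewrite big_cons; apply: (KM); first exact/KT'/v'T/mem_head.
  by apply: IHv => u uv; apply: v'T; rewrite inE uv orbT.
by rewrite -(mulgK (\prod_(y <- v) y) x) -ew -eg; apply: (KM) => //; apply: (KV).
Qed.

End FiniteTransversal.

(** * Finitely generated torsion nilpotent groups *)

Section NilpotentTorsion.
Variables (G : groupType) (H : set G).
Hypothesis sgH : is_subgroup H.
Implicit Types (x y z g t c : G) (K : set G) (X T : seq G).

Fixpoint bounded_products N T : seq G :=
  if T is t :: T' then
    [seq t ^+ e * c | e <- iota 0 N, c <- bounded_products N T'] else [:: 1].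

Section Layer.
Variable i : nat.
Local Notation Z := (upper_central H i).
Local Notation Z1 := (upper_central H i.+1).

Lemma layer_congr x y x' y' : H x' -> Z (y^-1 * x) -> Z (y'^-1 * x') ->
  Z ((y * y')^-1 * (x * x')).
Proof.
move=> Hx' Zx Zx'; have [_ ZM _] := (is_subgroupP _).1 (upper_central_subgroup sgH i).
have -> : (y * y')^-1 * (x * x') = (y'^-1 * x') * (y^-1 * x) ^ x'.
  by rewrite conjgE invgM !mulgA mulgK.
by apply: ZM => //; exact: upper_central_conj.
Qed.

Lemma layer_trans x y z : Z (y^-1 * x) -> Z (z^-1 * y) -> Z (z^-1 * x).
Proof.
move=> Zx Zy; have [_ ZM _] := (is_subgroupP _).1 (upper_central_subgroup sgH i).
by have := ZM _ _ Zy Zx; rewrite mulgA mulgK.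
Qed.

Lemma bounded_products_sub N T : (forall t, t \in T -> Z1 t) ->
  forall c, c \in bounded_products N T -> Z1 c.
Proof.
have [Z1one Z1M _] := (is_subgroupP _).1 (upper_central_subgroup sgH i.+1).
have Z1X t n : Z1 t -> Z1 (t ^+ n).
  by move=> Zt; elim: n => // n IHn; rewrite expgS; apply: (Z1M).
elim: T => [|t T IHT] ZT c; first by rewrite inE => /eqP->.
case/allpairsP => -[e d] /= [_ dT ->]; apply: (Z1M); first exact/Z1X/ZT/mem_head.
by apply: IHT dT => s sT; apply: ZT; rewrite inE sT orbT.
Qed.

(** Modulo [Z] the elements of [Z1] commute, so a factor can be moved to its place
    and its exponent reduced. *)
Lemma bounded_products_mul N T t c : (0 < N)%N ->
  (forall s, s \in T -> Z1 s /\ s ^+ N = 1) -> t \in T ->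
  c \in bounded_products N T ->
  exists2 c', c' \in bounded_products N T & Z (c'^-1 * (t * c)).
Proof.
move=> N0; have [Zone _ _] := (is_subgroupP _).1 (upper_central_subgroup sgH i).
have Z1H x : Z1 x -> H x by exact: upper_central_sub.
elim: T c => [|s T IHT] c ZT //; rewrite inE => tT.
have ZT' r : r \in T -> Z1 r /\ r ^+ N = 1.
  by move=> rT; apply: ZT; rewrite inE rT orbT.
case/allpairsP => -[e d] /= [eN dT ->].
have [Zs sN] := ZT s (mem_head _ _).
have [est|nts] := eqVneq t s.
  exists (s ^+ (e.+1 %% N) * d).
    by apply/allpairsP; exists (e.+1 %% N, d); rewrite mem_iota ltn_mod.
  have -> : s ^+ (e.+1 %% N) = s ^+ e.+1.
    by rewrite [in RHS](divn_eq e.+1 N) expgnDr mulnC expgnA sN expg1n mul1g.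
  by rewrite est expgS -mulgA mulVg.
rewrite (negPf nts) /= in tT.
have [d' d'T Zd] := IHT d ZT' tT dT.
exists (s ^+ e * d'); first by apply/allpairsP; exists (e, d').
have HM : forall x y, H x -> H y -> H (x * y) by have [] := (is_subgroupP H).1 sgH.
have Hd : H d.
  by apply/Z1H; apply: (bounded_products_sub (N := N)) dT => r /ZT'[].
have Ht : H t by apply/Z1H; have [] := ZT' t tT.
have He : H (s ^+ e).
  elim: (e) => [|m IHm]; first by have [] := (is_subgroupP H).1 sgH.
  by rewrite expgS; apply: HM => //; exact: Z1H.
apply: (@layer_trans _ (s ^+ e * (t * d))).
  rewrite (mulgA t) (mulgA (s ^+ e)); apply: layer_congr => //; last by rewrite mulVg.
  have -> : (s ^+ e * t)^-1 * (t * s ^+ e) = [~ t, s ^+ e].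
    by rewrite commgEl conjgE invgM !mulgA.
  by have [[_ Zt] _] := ZT' t tT; exact: Zt.
by apply: layer_congr => //; [exact: HM | rewrite mulVg].
Qed.

(** [Z1] is finitely generated by Schreier's lemma, and abelian and torsion modulo
    [Z]; so the products of its generators with bounded exponents represent all its
    cosets of [Z]. *)
Lemma layer_transversal : (forall g, exists2 n, (0 < n)%N & g ^+ n = 1) ->
  (exists T, monoid_generates T setT) ->
  finite_transversal Z1 -> finite_transversal Z.
Proof.
move=> tors [T0 genT0] trZ1.
have [T [ZT genT]] := schreier (upper_central_subgroup sgH i.+1) trZ1 genT0.
have [N N0 TN] : exists2 N, (0 < N)%N & forall t, t \in T -> t ^+ N = 1.
  elim: (T) => [|t T' [N N0 TN]]; first by exists 1%N.
  have [n n0 tn] := tors t; exists (n * N)%N; first by rewrite muln_gt0 n0.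
  move=> s; rewrite inE => /orP[/eqP->|sT]; first by rewrite expgnA tn expg1n.
  by rewrite mulnC expgnA TN // expg1n.
have [X XP] := trZ1.
exists [seq x * c | x <- X, c <- bounded_products N T] => g.
have [x [xX Zx]] := XP g; have [w wT ew] := genT _ Zx.
have [c cT Zc] : exists2 c, c \in bounded_products N T & Z (c^-1 * \prod_(y <- w) y).
  have [Zone _ _] := (is_subgroupP _).1 (upper_central_subgroup sgH i).
  elim: w wT {ew} => [|t w IHw] wT.
    exists 1; last by rewrite big_nil mulg1 invg1.
    elim: (T) => [|s T' IHT]; first exact: mem_head.
    by apply/allpairsP; exists (0%N, 1); rewrite mem_iota N0 mulg1.
  have [|c cT Zc] := IHw; first by move=> z zw; apply: wT; rewrite inE zw orbT.
  have tT : t \in T by exact/wT/mem_head.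
  have [|c' c'T Zc'] := bounded_products_mul N0 _ tT cT.
    by move=> s sT; split; [exact: ZT | exact: TN].
  exists c' => //; rewrite big_cons; apply: layer_trans Zc'.
  by rewrite invgM -mulgA mulKg.
exists (x * c); split; first by apply/allpairsP; exists (x, c).
by rewrite invgM -mulgA ew.
Qed.

End Layer.

(** By descending induction all terms of the upper central series have finite index,
    down to the trivial one. *)
Lemma torsion_nilpotent_finite : nilpotent H -> finite_transversal H ->
  (forall g, exists2 n, (0 < n)%N & g ^+ n = 1) ->
  (exists T, monoid_generates T setT) ->
  finite_set [set: G]%classic.
Proof.
move=> [c ec] trH tors fgG.
have [X XP] : finite_transversal (upper_central H 0).
  rewrite -ec in trH; elim: c {ec} trH => // i IHi trZ.
  exact/IHi/layer_transversal.
apply: (@sub_finite_set _ _ [set` X]%classic) (finite_seq X) => g _ /=.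
have [x [xX /= e]] := XP g.
by rewrite -(mulVKg x g) e mulg1.
Qed.

End NilpotentTorsion.

(** * Free monoids and nilpotent groups *)

Section FreeSubmonoid.
Variable G : groupType.
Implicit Types (a b x y : G) (bs cs : seq bool).

Definition eval_word x y bs : G := \prod_(c <- bs) (if c then x else y).

Lemma eval_word_cat x y bs cs :
  eval_word x y (bs ++ cs) = eval_word x y bs * eval_word x y cs.
Proof. exact: big_cat. Qed.

Lemma free_pair_expg a b k : (0 < k)%N -> free_pair a b ->
  free_pair (a ^+ k) (b ^+ k).
Proof.
case: k => // k _ fab bs cs sbc.
have evX ds : \prod_(c <- ds) (if c then a ^+ k.+1 else b ^+ k.+1)
    = eval_word a b (flatten (map (nseq k.+1) ds)).
  elim: ds => [|d ds IHds]; first by rewrite /eval_word !big_nil.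
  rewrite big_cons IHds [in RHS]/= -cat_cons eval_word_cat; congr (_ * _).
  rewrite -[d :: _]/(nseq k.+1 d) /eval_word big_nseq -Monoid.iteropE.
  by case: d.
rewrite !evX => /fab e.
have {}e : flatten (map (nseq k.+1) bs) = flatten (map (nseq k.+1) cs).
  apply: e; rewrite !size_flatten /shape -!map_comp.
  have sz ds : sumn (map (size \o nseq k.+1) ds) = (size ds * k.+1)%N.
    by elim: ds => //= d ds ->; rewrite size_nseq mulSn.
  by rewrite !sz sbc.
elim: bs cs sbc e => [|b' bs IHbs] [|c' cs] //= [sbc] [-> /eqP].
by rewrite eqseq_cat ?size_nseq // => /andP[_ /eqP /(IHbs _ sbc)->].
Qed.

(** A pair of complementary Thue-Morse words. *)
Fixpoint thue_morse n : seq bool * seq bool :=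
  if n is m.+1 then let: (u, v) := thue_morse m in (u ++ v, v ++ u)
  else ([:: true], [:: false]).

Lemma thue_morse_neq n : (thue_morse n).1 <> (thue_morse n).2.
Proof.
have : ohead (thue_morse n).1 = Some true /\ ohead (thue_morse n).2 = Some false.
  elim: n => //= n; case: (thue_morse n) => u v /= [].
  by case: u => // a u; case: v => // b v [->] [->].
by move=> [] + + e; rewrite e => ->.
Qed.

Lemma thue_morse_size n : size (thue_morse n).1 = size (thue_morse n).2.
Proof.
elim: n => //= n; case: (thue_morse n) => u v /= e.
by rewrite !size_cat addnC.
Qed.

(** A semigroup law of Malcev type for nilpotent groups: if the values of the two
    words differ by [z], then those of the next two words differ by the commutator of
    [z] with one of them, which lies one step lower in the central series. *)
Lemma thue_morse_law (H : set G) i m x y : is_subgroup H ->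
  upper_central H (i + m) = H -> H x -> H y ->
  upper_central H m ((eval_word x y (thue_morse i).2)^-1
                     * eval_word x y (thue_morse i).1).
Proof.
move=> sgH + Hx Hy; have [H1 HM HV] := (is_subgroupP H).1 sgH.
have Hev bs : H (eval_word x y bs).
  rewrite /eval_word; elim: bs => [|c bs IHbs]; first by rewrite big_nil.
  by rewrite big_cons; apply: (HM) => //; case: c.
elim: i m => [|i IHi] m em.
  by rewrite add0n in em; rewrite em; apply: (HM) => //; exact: HV.
rewrite addSnnS in em; have := IHi _ em; rewrite /=.
case: (thue_morse i) => u v /= [_ Zuv]; rewrite !eval_word_cat.
set U := eval_word x y u in Zuv *; set V := eval_word x y v in Zuv *.
have -> : (V * U)^-1 * (U * V) = [~ V^-1 * U, V].
  by rewrite commgEl conjgE !invgM !invgK !mulgA mulgK.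
exact/Zuv/Hev.
Qed.

(** Suitable powers of [a] and [b] lie in the nilpotent subgroup, where the last two
    Thue-Morse words agree. *)
Lemma virtually_nilpotent_not_free a b : virtually_nilpotent G -> ~ free_pair a b.
Proof.
move=> [H [sgH fiH [n en]]] fab.
have trH := finite_index_transversal sgH fiH.
have [i i0 Ha] := finite_transversal_expg a sgH trH.
have [j j0 Hb] := finite_transversal_expg b sgH trH.
have HX x m : H x -> H (x ^+ m).
  have [H1 HM _] := (is_subgroupP H).1 sgH.
  by move=> Hx; elim: m => // m IHm; rewrite expgS; apply: (HM).
have ij0 : (0 < i * j)%N by rewrite muln_gt0 i0.
have Haij : H (a ^+ (i * j)) by rewrite expgnA; exact: HX.
have Hbij : H (b ^+ (i * j)) by rewrite mulnC expgnA; exact: HX.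
have := @thue_morse_law H n 0 _ _ sgH _ Haij Hbij.
rewrite addn0 => /(_ en) /= /mulg1_eq; rewrite invgK => e.
exact: thue_morse_neq (free_pair_expg ij0 fab (thue_morse_size n) (esym e)).
Qed.

End FreeSubmonoid.

Section Generators.
Variables (M : mealy) (invM : invertible M) (G : groupType).
Hypothesis genG : generates invM G.

Lemma generates_monoid : exists T : seq G, monoid_generates T setT.
Proof.
have [f bij_f] := genG.
exists [seq word_elt f [:: x] | x <- enum (state (enriched invM))] => g _.
have [w <-] := word_elt_surj bij_f g.
exists [seq word_elt f [:: x] | x <- w].
  by move=> _ /mapP[x _ ->]; apply/mapP; exists x; rewrite ?mem_enum.
by rewrite -[in LHS](flatten_seq1 w) word_elt_flatten !big_map.
Qed.

Lemma generates_finitely : exists S : set G, finite_set S /\ generating S.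
Proof.
have [T genT] := generates_monoid.
exists [set` T]%classic; split; first exact: finite_seq.
move=> g; have [w wT ->] := genT g I; exists (size w), w.
by split=> // x /wT; left.
Qed.

Lemma generates_free_pair : reversible M ->
  (exists g : G, infinite_order g) -> exists a b : G, free_pair a b.
Proof.
move=> revM [g infg]; have [f bij_f] := genG.
exact: (automaton_free_pair bij_f revM infg).
Qed.

End Generators.

Theorem corollary1p2 (R : realType) :
  (forall (M : mealy) (invM : invertible M), reversible M ->
     forall G : groupType, generates invM G ->
     (exists g : G, infinite_order g) -> exponential_growth G R)
  /\
  (forall G : groupType, infinite_set [set: G]%classic ->
     virtually_nilpotent G ->
     ~ (exists (M : mealy) (invM : invertible M),
          reversible M /\ generates invM G)).
Proof.
split=> [M invM revM G genG infG|G infG vnG [M [invM [revM genG]]]].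
  have [a [b fab]] := generates_free_pair genG revM infG.
  exact: free_pair_exponential_growth (generates_finitely genG) fab.
apply: infG; have [H [sgH fiH nilH]] := vnG.
apply: (torsion_nilpotent_finite sgH nilH (finite_index_transversal sgH fiH)).
  move=> g; apply: contrapT => infg.
  have [|a [b]] := generates_free_pair genG revM; last first.
    exact: virtually_nilpotent_not_free.
  by exists g => n n0 gn; apply: infg; exists n.
exact: generates_monoid genG.
Qed.
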